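(* Let $L\colon\widehat{\mathcal M}'_T\to\mathbb C/4\pi^2\mathbb Z$, where $\widehat{\mathcal M}'_T=\{(u_1,u_2)\in\mathbb C^2:e^{u_1}+e^{u_2}=1\}$, be the function constructed from spin Chern-Simons theory as in the context, for any fixed choice of nonzero flat section $\tau'$. Then for all $(u_1,u_2)\in\widehat{\mathcal M}'_T$ and all $(n_1,n_2)\in\mathbb Z^2$, $$L(u_1+2\pi in_1,\,u_2+2\pi in_2)=L(u_1,u_2)+\pi i(n_1u_2-n_2u_1)+2\pi^2n_1n_2\pmod{4\pi^2\mathbb Z}.$$
   Context: Write $i=\sqrt{-1}$. Torus. $T=\mathbb R^2/\mathbb Z^2$ with coordinates $\theta^1,\theta^2$, oriented by $d\theta^1\wedge d\theta^2$, with the spin structure for which both coordinate loops inherit the bounding spin structure. The associated quadratic refinement of the intersection pairing is $\sigma(n_1,n_2)=n_1n_2\bmod 2$ on $H^1(T;\mathbb Z/2)$, in the standard basis. Moduli spaces. $\widehat{\mathcal M}_T=\mathbb C^2$ with coordinates $u_1,u_2$; $\mathcal M_T=(\mathbb C^\times)^2$ with coordinates $\mu_1,\mu_2$; $e\colon\widehat{\mathcal M}_T\to\mathcal M_T$, $e(u_1,u_2)=(e^{u_1},e^{u_2})$, a principal $\mathbb Z^2$-bundle. $\widehat{\mathcal M}'_T=\{e^{u_1}+e^{u_2}=1\}\subset\widehat{\mathcal M}_T$, $\mathcal M'_T=\{\mu_1+\mu_2=1\}\subset\mathcal M_T$, and $e'\colon\widehat{\mathcal M}'_T\to\mathcal M'_T$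 is the restriction of $e$. Universal connection. On the trivial principal $\mathbb C^\times$-bundle $\widehat{\mathcal M}_T\times T\times\mathbb C^\times\to\widehat{\mathcal M}_T\times T$ with section $\hat t_0(u,\theta)=(u,\theta,1)$, let $\hat\eta$ be the connection with $\hat t_0^*\hat\eta=-u_1d\theta^1-u_2d\theta^2$. The action $(n_1,n_2)\cdot(u_1,u_2,\theta^1,\theta^2,\lambda)=(u_1+2\pi in_1,u_2+2\pi in_2,\theta^1,\theta^2,e^{2\pi i(n_1\theta^1+n_2\theta^2)}\lambda)$ of $\mathbb Z^2$ preserves $\hat\eta$, so the bundle with connection descends to $\rho\colon\mathcal Q\to\mathcal M_T\times T$ with connection $\eta$, of curvature $\Omega(\eta)$. It is flat along each $\{\mu\}\times T$. Spin Chern-Simons line bundle. $\mathcal L\to\mathcal M_T$ is the line bundle whose fiber at $\mu$ is the space of functions $f$ on the set of smooth sections $t$ of $\mathcal Q|_{\{\mu\}\times T}\to T$ satisfying $$f(t\cdot h)=(-1)^{\sigma([h])}\exp\Bigl(-\frac{i}{4\pi}\int_Tt^*\eta\wedge\frac{dh}{h}\Bigr)f(t)$$ for all smooth $h\colon T\to\mathbb C^\times$, where $[h]\in H^1(T;\mathbb Z/2)$ is the mod 2 reduction of the homotopy class of $h$. A section $t$ of $\mathcal Q$ over $U\times T$, $U\subset\mathcal M_T$ open, gives a trivialization $\tau_t$ of $\mathcal L|_U$ (the function with value $1$ at $t$), and the covariant derivative on $\mathcal L$ is determined by $\nabla\tau_t=\bigl(\frac{i}{4\pi}\int_Tt^*\eta\wedge\Omega(\eta)\bigr)\tau_t$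 (integration over the fiber $T$). In the same way $\hat t_0$ gives a trivialization $\hat\tau_0$ of $e^*\mathcal L\to\widehat{\mathcal M}_T$. Let $\mathcal L'=\mathcal L|_{\mathcal M'_T}$ and let $\hat\tau_0'$ be the restriction of $\hat\tau_0$ to $\widehat{\mathcal M}'_T$. The function $L$. The bundle $\mathcal L'\to\mathcal M_T'$ is flat with trivial holonomy, so it has nonzero flat sections $\tau'$, unique up to a constant in $\mathbb C^\times$. For a choice of $\tau'$ set $\varphi=\hat\tau_0'/(e')^*\tau'\colon\widehat{\mathcal M}'_T\to\mathbb C^\times$ and define $L\colon\widehat{\mathcal M}'_T\to\mathbb C/4\pi^2\mathbb Z$ by $\varphi=\exp(L/2\pi i)$. Changing $\tau'$ changes $L$ by an additive constant. *)

(* Defs.v *)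
From Stdlib Require Import Reals ZArith.
From Coquelicot Require Import Coquelicot.

Open Scope R_scope.
Open Scope C_scope.

(** * Calculus for complex-valued functions of real variables *)

Definition Cexp (z : C) : C :=
  (exp (Re z) * cos (Im z), exp (Re z) * sin (Im z))%R.

(** Derivative of [f] at [x] along [v]; a total operator, as [Derive] is. *)
Definition Dir {X : NormedModule R_AbsRing} (f : X -> C) (x v : X) : C :=
  (Derive (fun s : R => Re (f (plus x (scal s v)))) 0%R,
   Derive (fun s : R => Im (f (plus x (scal s v)))) 0%R).

(** [Ck k D f] for an open set [D].  Every space [X] used below is
    finite-dimensional, so this is the usual class C^k. *)
Fixpoint Ck {X : NormedModule R_AbsRing} (k : nat) (D : X -> Prop)
    (f : X -> C) : Prop :=
  match k with
  | O => forall x, D x -> continuous (T := X) (U := C_R_NormedModule) f x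
  | S k' =>
      (forall x, D x ->
         filterdiff (U := X) (V := C_R_NormedModule) f (locally x) (Dir f x))
      /\ (forall v, Ck k' D (fun x => Dir f x v))
  end.

Definition smooth {X : NormedModule R_AbsRing} (D : X -> Prop)
    (f : X -> C) : Prop :=
  forall k, Ck k D f.

(** A complex-valued p-form is the function of a base point and p tangent
    vectors (constant vector fields, as the ambient space is linear). *)
Definition form1 (X : NormedModule R_AbsRing) := X -> X -> C.
Definition form2 (X : NormedModule R_AbsRing) := X -> X -> X -> C.
Definition form3 (X : NormedModule R_AbsRing) := X -> X -> X -> X -> C.

Definition ext_d {X : NormedModule R_AbsRing} (a : form1 X) : form2 X :=
  fun x v w => Dir (fun y => a y w) x v - Dir (fun y => a y v) x w.

Definition wedge11 {X : NormedModule R_AbsRing} (a b : form1 X) : form2 X :=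
  fun x v w => a x v * b x w - a x w * b x v.

Definition wedge12 {X : NormedModule R_AbsRing} (a : form1 X) (b : form2 X)
    : form3 X :=
  fun x v1 v2 v3 =>
    a x v1 * b x v2 v3 - a x v2 * b x v1 v3 + a x v3 * b x v1 v2.

Definition dlog {X : NormedModule R_AbsRing} (h : X -> C) : form1 X :=
  fun x v => Dir h x v / h x.

(** * The torus T = R^2 / Z^2 *)

(** Functions on T are Z^2-periodic functions on its universal cover. *)
Definition plane : Type := (R * R)%type.
Definition plane_mod : NormedModule R_AbsRing :=
  prod_NormedModule R_AbsRing R_NormedModule R_NormedModule.

Definition e1 : plane_mod := (1, 0)%R.
Definition e2 : plane_mod := (0, 1)%R.

Definition translate (m : Z * Z) (theta : plane) : plane :=
  (fst theta + IZR (fst m), snd theta + IZR (snd m))%R.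

Definition periodic (h : plane -> C) : Prop :=
  forall m theta, h (translate m theta) = h theta.

Definition torus_map (h : plane -> C) : Prop :=
  smooth (X := plane_mod) (fun _ => True) h /\ periodic h /\ forall theta, h theta <> 0.

Definition int_T (F : plane -> C) : C :=
  RInt (V := C_R_CompleteNormedModule)
    (fun x => RInt (V := C_R_CompleteNormedModule) (fun y => F (x, y)) 0 1)
    0 1.

Definition int_T_form2 (w : form2 plane_mod) : C :=
  int_T (fun theta => w theta e1 e2).

(** The character [theta |-> exp (2 pi i (n1 theta1 + n2 theta2))]. *)
Definition char (n : Z * Z) (theta : plane) : C :=
  Cexp (2 * PI * Ci
        * (IZR (fst n) * fst theta + IZR (snd n) * snd theta)%R).

(** The homotopy class of [h : T -> C^*], as an element of H^1(T; Z) = Z^2 in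
    the standard basis: [h] is freely homotopic to the character [char n].
    A homotopy over [0, 1] extends constantly to all real times. *)
Definition homotopy_class (h : plane -> C) (n : Z * Z) : Prop :=
  exists H : R * plane -> C,
    (forall p, continuous
       (T := prod_NormedModule R_AbsRing R_NormedModule plane_mod)
       (U := C_R_NormedModule) H p) /\
    (forall s, periodic (fun theta => H (s, theta))) /\
    (forall s theta, H (s, theta) <> 0) /\
    (forall theta, H (0%R, theta) = h theta) /\
    (forall theta, H (1%R, theta) = char n theta).

(** The quadratic refinement on H^1(T; Z/2) = (Z/2)^2, with Z/2 = bool. *)
Definition spin_sigma (a : bool * bool) : bool := andb (fst a) (snd a).

Definition mod2 (n : Z * Z) : bool * bool := (Z.odd (fst n), Z.odd (snd n)).

Definition spin_sign (b : bool) : C := if b then - (1) else 1.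

(** * Moduli spaces *)

(** The ambient space of both [Mhat_T = C^2] and [M_T = C^* x C^*]. *)
Definition C2 : Type := (C * C)%type.
Definition C2_mod : NormedModule R_AbsRing :=
  prod_NormedModule R_AbsRing C_R_NormedModule C_R_NormedModule.

Definition cov (u : C2) : C2 := (Cexp (fst u), Cexp (snd u)).

Definition deck (n : Z * Z) (u : C2) : C2 :=
  (fst u + 2 * PI * Ci * IZR (fst n), snd u + 2 * PI * Ci * IZR (snd n)).

Definition Mhat' (u : C2) : Prop := Cexp (fst u) + Cexp (snd u) = 1.

Definition M' (mu : C2) : Prop :=
  fst mu <> 0 /\ snd mu <> 0 /\ fst mu + snd mu = 1.

(** * The universal bundle with connection *)

(** A point [(u, theta, lambda)] of the trivial C^*-bundle over
    [Mhat_T * T], with [theta] in the universal cover of T. *)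
Definition Qhat : Type := (C2 * plane * C)%type.

(** The points of the quotient Q are the orbits in [Qhat] (with
    [lambda <> 0]) of the Z^2 of periods of T together with the Z^2 acting on
    the bundle; the two actions commute. *)
Definition Qpt : Type := Qhat -> Prop.

Definition orbit (u : C2) (theta : plane) (lambda : C) : Qpt :=
  fun q => exists n m : Z * Z,
    q = (deck n u, translate m theta, char n theta * lambda).

(** The principal right action of C^* on Q. *)
Definition Q_act (x : Qpt) (c : C) : Qpt :=
  fun q => exists u theta lambda,
    x (u, theta, lambda) /\ q = (u, theta, lambda * c).

(** The pullback along [s] of the connection
    [d lambda / lambda - u1 d theta1 - u2 d theta2], whose pullback along
    [lambda = 1] is [- u1 d theta1 - u2 d theta2].  It is invariant under both
    Z^2 actions, so if [s] lifts a map to Q this is the pullback of the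
    connection of Q. *)
Definition pullback_eta {X : NormedModule R_AbsRing} (s : X -> Qhat)
    : form1 X :=
  fun x v =>
    let '(u, _, lambda) := s x in
    Dir (fun y => snd (s y)) x v / lambda
    - fst u * Dir (fun y => RtoC (fst (snd (fst (s y))))) x v
    - snd u * Dir (fun y => RtoC (snd (snd (fst (s y))))) x v.

(** * Sections of Q *)

(** [t] is the smooth section of Q over [{mu} * T] that lifts to
    [theta |-> (u, theta, g theta)].  Each choice of [u] over [mu] trivializes
    Q over [{mu} * T], so every smooth section has such a lift. *)
Definition lift_at (mu : C2) (t : plane -> Qpt) (u : C2) (g : plane -> C)
    : Prop :=
  cov u = mu /\ torus_map g /\ forall theta, t theta = orbit u theta (g theta).

Definition section_at (mu : C2) (t : plane -> Qpt) : Prop :=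
  exists u g, lift_at mu t u g.

Definition act_section (t : plane -> Qpt) (h : plane -> C) : plane -> Qpt :=
  fun theta => Q_act (t theta) (h theta).

Definition C2xT : Type := (C2 * plane)%type.
Definition C2xT_mod : NormedModule R_AbsRing :=
  prod_NormedModule R_AbsRing C2_mod plane_mod.

(** [t] is the smooth section of Q over [V * T], V open in [M_T], that lifts
    to [(mu, theta) |-> (u mu, theta, g (mu, theta))], where [u] is a smooth
    branch of the logarithm on V. *)
Definition lift_over (V : C2 -> Prop) (t : C2 -> plane -> Qpt)
    (u : C2 -> C2) (g : C2xT -> C) : Prop :=
  open (T := C2_mod) V /\
  (forall mu, V mu -> cov (u mu) = mu) /\
  smooth (X := C2_mod) V (fun mu => fst (u mu)) /\
  smooth (X := C2_mod) V (fun mu => snd (u mu)) /\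
  smooth (X := C2xT_mod) (fun x => V (fst x)) g /\
  (forall mu, V mu -> periodic (fun theta => g (mu, theta))) /\
  (forall mu theta, V mu -> g (mu, theta) <> 0) /\
  (forall mu theta, V mu -> t mu theta = orbit (u mu) theta (g (mu, theta))).

(** The section [t0hat] of the bundle over [{u} * T], seen in Q. *)
Definition t0hat (u : C2) : plane -> Qpt := fun theta => orbit u theta 1.

(** * The spin Chern-Simons line bundle *)

(** [f] is an element of the fiber at [mu].  Only the values of [f] at the
    sections over [{mu} * T] are meaningful: elements of the fiber are
    compared on these only.  Every [h] has exactly one homotopy class [n], and
    the integral does not depend on the lift [u, g] of [t]. *)
Definition in_fiber (mu : C2) (f : (plane -> Qpt) -> C) : Prop :=
  forall t u g h n,
    lift_at mu t u g -> torus_map h -> homotopy_class h n ->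
    f (act_section t h)
    = spin_sign (spin_sigma (mod2 n))
      * Cexp (- (Ci / (4 * PI))
              * int_T_form2
                  (wedge11
                     (pullback_eta (X := plane_mod)
                        (fun theta => (u, theta, g theta)))
                     (dlog h)))
      * f t.

(** The 1-form [alpha] with [nabla tau_t = alpha * tau_t], for the section [t]
    with lift [u, g].  Since C^* is abelian, the curvature pulled back to the
    base is [d (t^* eta)].  The fiber T is even-dimensional, so integration
    over it carries no sign convention. *)
Definition conn_form (u : C2 -> C2) (g : C2xT -> C) : form1 C2_mod :=
  fun mu xi =>
    let a := pullback_eta (X := C2xT_mod)
               (fun x => (u (fst x), snd x, g x)) in
    Ci / (4 * PI)
    * int_T (fun theta =>
        wedge12 a (ext_d a) (mu, theta) (xi, zero) (zero, e1) (zero, e2)).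

(** [tau] is a flat section of the line bundle over [M'].  If [t] is a section
    of Q over [V * T] then [tau = phi * tau_t] over V with
    [phi mu = tau mu (t mu)], and [nabla tau = 0] says that the function [phi]
    on the submanifold M' has differential the restriction of [- alpha * phi]
    to the tangent space of M'.  Every section of Q over an open set times T
    is locally of the form [lift_over]; smoothness of [phi] follows. *)
Definition flat_section (tau : C2 -> (plane -> Qpt) -> C) : Prop :=
  (forall mu, M' mu -> in_fiber mu (tau mu)) /\
  (forall V t u g mu,
     lift_over V t u g -> V mu -> M' mu ->
     filterdiff (U := C2_mod) (V := C_R_NormedModule)
       (fun nu => tau nu (t nu))
       (within M' (locally (T := C2_mod) mu))
       (fun xi => - conn_form u g mu xi * tau mu (t mu))).

Definition nonzero_section (tau : C2 -> (plane -> Qpt) -> C) : Prop :=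
  exists mu t, M' mu /\ section_at mu t /\ tau mu t <> 0.

(** [tau0] is the trivialization of the pullback of the line bundle to
    [Mhat_T] that has value 1 at [t0hat]. *)
Definition trivialization0 (tau0 : C2 -> (plane -> Qpt) -> C) : Prop :=
  forall u, in_fiber (cov u) (tau0 u) /\ tau0 u (t0hat u) = 1.

(** * The function L *)

(** [phi] is the quotient of [tau0] by the pullback of [tau], on [Mhat']. *)
Definition is_quotient (phi : C2 -> C) (tau0 tau : C2 -> (plane -> Qpt) -> C)
    : Prop :=
  forall u, Mhat' u -> forall t, section_at (cov u) t ->
    tau0 u t = phi u * tau (cov u) t.

(** [L] picks, at each point of [Mhat'], a representative in C of the class
    modulo [4 pi^2 Z] determined by [phi = exp (L / (2 pi i))]. *)
Definition CS_function (tau : C2 -> (plane -> Qpt) -> C) (L : C2 -> C) : Prop :=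
  exists (tau0 : C2 -> (plane -> Qpt) -> C) (phi : C2 -> C),
    trivialization0 tau0 /\ is_quotient phi tau0 tau /\
    forall u, Mhat' u -> phi u = Cexp (L u / (2 * PI * Ci)).

Definition eq_mod_4pi2 (z w : C) : Prop :=
  exists k : Z, z - w = 4 * PI ^ 2 * IZR k.

(* Main.v *)
(** The sections [t0hat u] and [t0hat (deck n u)] of [Q] over the same torus
    differ by the gauge transformation [char (- n)].  Since [tau0] is 1 on each,
    the ratio of the values of [phi] at [deck n u] and [u] is the inverse of the
    factor by which [tau] changes under that gauge transformation.  That factor
    is given by the definition of the fiber: the sign contributes
    [2 pi^2 n1 n2] to [L], and the integral of
    [(- u1 d theta1 - u2 d theta2) /\ (- 2 pi i) (n1 d theta1 + n2 d theta2)]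
    contributes the linear term. *)

Require Import Defs.
From Stdlib Require Import Reals ZArith Lra Lia.
From Stdlib Require Import FunctionalExtensionality PropExtensionality.
From Coquelicot Require Import Coquelicot.
Open Scope C_scope.

(** * The complex exponential and its kernel *)

Lemma Cexp_plus (z w : C) : Cexp (z + w) = Cexp z * Cexp w.
Proof.
  destruct z as [a b], w as [c d]; unfold Cexp, Cplus, Cmult; simpl.
  rewrite exp_plus, cos_plus, sin_plus.
  f_equal; ring.
Qed.

Lemma Cexp_0 : Cexp 0 = 1.
Proof.
  unfold Cexp; simpl; rewrite exp_0, cos_0, sin_0.
  unfold RtoC; f_equal; ring.
Qed.

Lemma Cexp_neq_0 (z : C) : Cexp z <> 0.
Proof.
  intros H.
  apply C1_nz.
  rewrite <- Cexp_0.
  replace (RtoC 0) with (z + (- z)) by ring.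
  rewrite Cexp_plus, H; ring.
Qed.

Lemma Cexp_opp (z : C) : Cexp (- z) = / Cexp z.
Proof.
  assert (H : Cexp z * Cexp (- z) = 1).
  { rewrite <- Cexp_plus, <- Cexp_0; f_equal; ring. }
  rewrite <- (Cmult_1_r (/ Cexp z)), <- H; field; apply Cexp_neq_0.
Qed.

Lemma Cexp_iR (x : R) : Cexp (Ci * x) = (cos x, sin x).
Proof.
  unfold Cexp; simpl.
  replace (0 * x - 1 * 0)%R with 0%R by ring.
  replace (0 * 0 + 1 * x)%R with x by ring.
  rewrite exp_0; f_equal; ring.
Qed.

Lemma Cexp_2PIi (k : Z) : Cexp (2 * PI * Ci * IZR k) = 1.
Proof.
  replace (2 * PI * Ci * IZR k) with (Ci * (2 * (IZR k * PI))%R)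
    by (rewrite !RtoC_mult; ring).
  (* The double-angle formulas reduce both components to the vanishing of sine at [IZR k * PI]. *)
  rewrite Cexp_iR, cos_2a_sin, sin_2a, (sin_eq_0_1 (IZR k * PI)) by eauto.
  unfold RtoC; f_equal; ring.
Qed.

(** The modulus forces the real part to vanish; the half-angle identity turns [cos b = 1] into
    [sin (b / 2) = 0], and the zeros of sine are the integer multiples of [PI]. *)
Lemma Cexp_eq_1 (z : C) : Cexp z = 1 -> exists k : Z, z = 2 * PI * Ci * IZR k.
Proof.
  destruct z as [a b]; unfold Cexp; simpl; intros H.
  injection H as Hc Hs.
  pose proof (exp_pos a) as Ha.
  assert (Hsin : sin b = 0%R).
  { destruct (Rmult_integral _ _ Hs); [lra | assumption]. }
  pose proof (sin2_cos2 b) as Hsc; unfold Rsqr in Hsc.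
  assert (Hexp : exp a = 1%R) by nra.
  assert (Ha0 : a = 0%R) by (apply exp_inv; rewrite exp_0; exact Hexp).
  assert (Hcos : cos b = 1%R) by nra.
  assert (Hhalf : sin (b / 2) = 0%R).
  { replace b with (2 * (b / 2))%R in Hcos by field.
    rewrite cos_2a_sin in Hcos; nra. }
  destruct (sin_eq_0_0 _ Hhalf) as [k Hk].
  exists k.
  replace (2 * PI * Ci * IZR k) with (Ci * (2 * (IZR k * PI))%R)
    by (rewrite !RtoC_mult; ring).
  rewrite <- Hk, Ha0.
  unfold Ci, RtoC, Cmult; simpl; f_equal; field.
Qed.

Lemma Cexp_eq (z w : C) :
  Cexp z = Cexp w -> exists k : Z, z - w = 2 * PI * Ci * IZR k.
Proof.
  intros H; apply Cexp_eq_1.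
  unfold Cminus; rewrite Cexp_plus, Cexp_opp, H.
  apply Cinv_r, Cexp_neq_0.
Qed.

(** * Directional derivatives and exponentials of linear phases *)

Section Differential.

Context {X : NormedModule R_AbsRing}.

(** [Dir] is built from one-variable derivatives; the chain rule along the line [x + s v], followed
    by the projections to real and imaginary parts, identifies it with the differential [l]. *)
Lemma filterdiff_Dir (f l : X -> C) (x v : X) :
  filterdiff (U := X) (V := C_R_NormedModule) f (locally x) l ->
  Dir f x v = l v.
Proof.
  intros Hf.
  assert (Hline : filterdiff (U := R_NormedModule) (V := X)
            (fun s => plus x (scal s v)) (locally 0%R) (fun s => scal s v)).
  { apply filterdiff_ext_lin with (fun s : R => plus zero (scal s v)).
    - apply (filterdiff_plus_fct (U := R_NormedModule) (V := X)).
      + apply (filterdiff_const (U := R_NormedModule) (V := X)).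
      + apply filterdiff_linear, (is_linear_scal_l (V := X) v).
    - intros s; apply plus_zero_l. }
  assert (Hx : plus x (scal 0%R v) = x)
    by (rewrite (scal_zero_l v : scal 0%R v = zero); apply plus_zero_r).
  rewrite <- Hx in Hf.
  pose proof (filterdiff_comp' _ _ _ _ _ Hline Hf) as Hcomp.
  assert (Hlin : forall s : R, l (scal s v) = scal (V := C_R_NormedModule) s (l v))
    by (intros s; apply (linear_scal (V := C_R_NormedModule) l (proj1 Hf))).
  unfold Dir; rewrite (surjective_pairing (l v)).
  f_equal; apply is_derive_unique.
  - eapply filterdiff_ext_lin.
    + apply (filterdiff_comp' (W := R_NormedModule) _ (@fst R R) _ _ (@fst R R) Hcomp).
      apply filterdiff_linear, (is_linear_fst (U := R_NormedModule) (V := R_NormedModule)).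
    + intros s; simpl; rewrite Hlin; reflexivity.
  - eapply filterdiff_ext_lin.
    + apply (filterdiff_comp' (W := R_NormedModule) _ (@snd R R) _ _ (@snd R R) Hcomp).
      apply filterdiff_linear, (is_linear_snd (U := R_NormedModule) (V := R_NormedModule)).
    + intros s; simpl; rewrite Hlin; reflexivity.
Qed.

Lemma filterdiff_C (f g lf lg : X -> R) (x : X) :
  filterdiff (U := X) (V := R_NormedModule) f (locally x) lf ->
  filterdiff (U := X) (V := R_NormedModule) g (locally x) lg ->
  filterdiff (U := X) (V := C_R_NormedModule)
    (fun y => (f y, g y)) (locally x) (fun v => (lf v, lg v)).
Proof.
  intros Hf Hg.
  apply (filterdiff_comp'_2 (W := C_R_NormedModule) f g pair x lf lg pair Hf Hg).
  apply filterdiff_linear, is_linear_prod.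
  - apply is_linear_fst.
  - apply is_linear_snd.
Qed.

Lemma Dir_const (c : C) (x v : X) : Dir (fun _ => c) x v = 0.
Proof. unfold Dir; rewrite !Derive_const; reflexivity. Qed.

Lemma Dir_linear (l : X -> R) (x v : X) :
  is_linear (V := R_NormedModule) l -> Dir (fun y => RtoC (l y)) x v = l v.
Proof.
  intros Hl.
  apply (filterdiff_Dir _ (fun y => RtoC (l y))).
  apply filterdiff_C.
  - now apply filterdiff_linear.
  - apply (filterdiff_const (V := R_NormedModule)).
Qed.

(** The free constant [c] makes the family stable under differentiation: the derivative along [v] is
    the same exponential with constant [c * (Ci * p v)]. *)
Lemma filterdiff_scal_Cexp (c : C) (p : X -> R) (x : X) :
  is_linear (V := R_NormedModule) p ->
  filterdiff (U := X) (V := C_R_NormedModule)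
    (fun y => c * Cexp (Ci * p y)) (locally x)
    (fun v => c * (Ci * p v) * Cexp (Ci * p x)).
Proof.
  intros Hp.
  assert (Hd : forall (f : R -> R) (d : R), is_derive f (p x) d ->
     filterdiff (U := X) (V := R_NormedModule) (fun y => f (p y)) (locally x)
       (fun v => p v * d)%R).
  { intros f d Hf.
    apply (filterdiff_comp' (V := R_NormedModule) (W := R_NormedModule)
             p f x p (fun s => s * d)%R).
    - apply filterdiff_linear, Hp.
    - exact Hf. }
  destruct c as [a b].
  apply filterdiff_ext with
    (fun y => (a * cos (p y) - b * sin (p y), a * sin (p y) + b * cos (p y))%R).
  { intros y; rewrite Cexp_iR; reflexivity. }
  eapply filterdiff_ext_lin.
  { apply filterdiff_C.
    - apply (Hd (fun s => a * cos s - b * sin s)%R); auto_derive; trivial.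
    - apply (Hd (fun s => a * sin s + b * cos s)%R); auto_derive; trivial. }
  intros v; rewrite Cexp_iR.
  unfold Ci, RtoC, Cmult; simpl; f_equal; ring.
Qed.

Lemma Dir_scal_Cexp (c : C) (p : X -> R) (x v : X) :
  is_linear (V := R_NormedModule) p ->
  Dir (fun y => c * Cexp (Ci * p y)) x v = c * (Ci * p v) * Cexp (Ci * p x).
Proof.
  intros Hp.
  apply (filterdiff_Dir _ (fun v => c * (Ci * p v) * Cexp (Ci * p x))).
  now apply filterdiff_scal_Cexp.
Qed.

Lemma smooth_Cexp (D : X -> Prop) (p : X -> R) :
  is_linear (V := R_NormedModule) p -> smooth D (fun y => Cexp (Ci * p y)).
Proof.
  intros Hp k.
  (* The claim is strengthened to all constants because each differentiation changes [c]. *)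
  assert (H : forall c, Ck k D (fun y => c * Cexp (Ci * p y))).
  { induction k as [| k IH]; intros c.
    - intros x _.
      apply (filterdiff_continuous (V := C_R_NormedModule)).
      eexists; apply (filterdiff_scal_Cexp c p x Hp).
    - split.
      + intros x _.
        eapply filterdiff_ext_lin; [apply (filterdiff_scal_Cexp c p x Hp) |].
        intros v; symmetry; apply (Dir_scal_Cexp c p x v Hp).
      + intros v.
        replace (fun x => Dir (fun y => c * Cexp (Ci * p y)) x v)
          with (fun x => c * (Ci * p v) * Cexp (Ci * p x)); [apply IH |].
        apply functional_extensionality; intros x; symmetry.
        apply (Dir_scal_Cexp c p x v Hp). }
  replace (fun y => Cexp (Ci * p y)) with (fun y => 1 * Cexp (Ci * p y));
    [apply H |].
  apply functional_extensionality; intros y; ring.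
Qed.

End Differential.

(** * Characters of the torus *)

Definition phase (n : Z * Z) (theta : plane) : R :=
  (2 * PI * (IZR (fst n) * fst theta + IZR (snd n) * snd theta))%R.

Lemma char_phase (n : Z * Z) : char n = fun theta => Cexp (Ci * phase n theta).
Proof.
  apply functional_extensionality; intros theta.
  unfold char, phase; f_equal.
  rewrite (RtoC_mult (2 * PI)), (RtoC_mult 2); ring.
Qed.

Lemma is_linear_phase (n : Z * Z) :
  is_linear (U := plane_mod) (V := R_NormedModule) (phase n).
Proof.
  assert (Hscal : forall (k : R) (p : plane -> R),
    is_linear (U := plane_mod) (V := R_NormedModule) p ->
    is_linear (U := plane_mod) (V := R_NormedModule) (fun t => k * p t)%R).
  { intros k p Hp.
    apply (is_linear_comp (V := R_NormedModule) (W := R_NormedModule) p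
             (fun x => k * x)%R Hp).
    apply (is_linear_scal_r (V := R_NormedModule) k), Rmult_comm. }
  apply Hscal.
  apply (is_linear_comp (U := plane_mod)
           (V := prod_NormedModule R_AbsRing R_NormedModule R_NormedModule)
           (W := R_NormedModule)
           (fun t => (IZR (fst n) * fst t, IZR (snd n) * snd t)%R)
           (fun t => plus (fst t) (snd t))).
  - apply is_linear_prod; apply Hscal.
    + apply is_linear_fst.
    + apply is_linear_snd.
  - apply is_linear_plus.
Qed.

Definition oppZ2 (n : Z * Z) : Z * Z := (- fst n, - snd n)%Z.

Lemma char_plus (n m : Z * Z) (theta : plane) :
  char (fst n + fst m, snd n + snd m)%Z theta = char n theta * char m theta.
Proof.
  unfold char; rewrite <- Cexp_plus; f_equal; simpl.
  rewrite !plus_IZR, !RtoC_plus, !RtoC_mult, !RtoC_plus; ring.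
Qed.

Lemma char_0 (theta : plane) : char (0, 0)%Z theta = 1.
Proof.
  rewrite <- Cexp_0; unfold char; f_equal; simpl.
  rewrite !Rmult_0_l, Rplus_0_r; ring.
Qed.

Lemma char_periodic (n : Z * Z) : periodic (char n).
Proof.
  intros m theta.
  unfold char, translate; simpl.
  (* The right-hand side receives a factor 1, then read as the exponential of
     [2 pi i (n1 m1 + n2 m2)], the change of the exponent under translation by [m]. *)
  rewrite <- (Cmult_1_r (Cexp (_ * (IZR (fst n) * fst theta + _)%R))).
  rewrite <- (Cexp_2PIi (fst n * fst m + snd n * snd m)), <- Cexp_plus.
  f_equal.
  rewrite plus_IZR, !mult_IZR.
  rewrite !RtoC_plus, !RtoC_mult, !RtoC_plus; ring.
Qed.

Lemma torus_map_char (n : Z * Z) : torus_map (char n).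
Proof.
  repeat split.
  - rewrite char_phase; apply smooth_Cexp, is_linear_phase.
  - apply char_periodic.
  - intros theta; apply Cexp_neq_0.
Qed.

Lemma torus_map_1 : torus_map (fun _ => 1).
Proof.
  replace (fun _ : plane => RtoC 1) with (char (0, 0)%Z).
  - apply torus_map_char.
  - apply functional_extensionality, char_0.
Qed.

Lemma homotopy_class_char (n : Z * Z) : homotopy_class (char n) n.
Proof.
  exists (fun p => char n (snd p)).
  split; [| split; [| split; [| split]]]; trivial.
  - intros p.
    apply (continuous_comp
             (U := prod_NormedModule R_AbsRing R_NormedModule plane_mod)
             (V := plane_mod) (W := C_R_NormedModule) snd (char n)).
    + apply continuous_snd.
    + destruct (torus_map_char n) as [Hs _].
      exact (Hs O (snd p) I).
  - intros s; apply char_periodic.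
  - intros s theta; apply Cexp_neq_0.
Qed.

(** [phase n] is linear, hence its own differential, so the logarithmic derivative is the same at
    every [theta]. *)
Lemma dlog_char (n : Z * Z) (theta v : plane) :
  dlog (X := plane_mod) (char n) theta v = Ci * phase n v.
Proof.
  unfold dlog.
  replace (char n) with (fun t => 1 * Cexp (Ci * phase n t)).
  - rewrite (Dir_scal_Cexp (X := plane_mod)) by apply is_linear_phase.
    field; apply Cexp_neq_0.
  - rewrite char_phase; apply functional_extensionality; intros t; ring.
Qed.

(** * The connection along the torus and its pairing with characters *)

Lemma pullback_eta_t0hat (u : C2) (theta v : plane) :
  pullback_eta (X := plane_mod) (fun theta => (u, theta, RtoC 1)) theta v
  = - fst u * fst v - snd u * snd v.
Proof.
  change (Dir (X := plane_mod) (fun _ => RtoC 1) theta v / 1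
          - fst u * Dir (X := plane_mod) (fun y => RtoC (@fst R R y)) theta v
          - snd u * Dir (X := plane_mod) (fun y => RtoC (@snd R R y)) theta v
          = - fst u * fst v - snd u * snd v).
  rewrite (Dir_const (X := plane_mod) 1 theta v).
  rewrite (Dir_linear (X := plane_mod) (@fst R R) theta v) by apply is_linear_fst.
  rewrite (Dir_linear (X := plane_mod) (@snd R R) theta v) by apply is_linear_snd.
  field; exact C1_nz.
Qed.

Lemma int_T_const (c : C) : int_T (fun _ => c) = c.
Proof.
  assert (H : RInt (V := C_R_CompleteNormedModule) (fun _ => c) 0 1 = c).
  { rewrite RInt_const, Rminus_0_r.
    apply (scal_one (V := C_R_NormedModule)). }
  unfold int_T; rewrite H; exact H.
Qed.

(** The integrand is constant: on [e1], [e2] the wedge is the determinant of the coefficient rows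
    [(- u1, - u2)] and [2 pi i (n1, n2)], and T has area 1. *)
Lemma int_T_eta_dlog_char (u : C2) (n : Z * Z) :
  int_T_form2
    (wedge11 (pullback_eta (X := plane_mod) (fun theta => (u, theta, RtoC 1)))
       (dlog (char n)))
  = 2 * PI * Ci * (IZR (fst n) * snd u - IZR (snd n) * fst u).
Proof.
  rewrite <- (int_T_const (_ * _)).
  unfold int_T_form2; f_equal.
  apply functional_extensionality; intros theta.
  unfold wedge11; rewrite !dlog_char, !pullback_eta_t0hat.
  unfold phase, e1, e2; simpl.
  rewrite !Rmult_0_r, !Rmult_1_r, Rplus_0_l, Rplus_0_r, !RtoC_mult; ring.
Qed.

(** * Deck transformations as gauge transformations *)

Lemma cov_deck (n : Z * Z) (u : C2) : cov (deck n u) = cov u.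
Proof.
  unfold cov, deck; simpl.
  rewrite !Cexp_plus, !Cexp_2PIi, !Cmult_1_r; reflexivity.
Qed.

Lemma deck_deck (n m : Z * Z) (u : C2) :
  deck n (deck m u) = deck (fst n + fst m, snd n + snd m)%Z u.
Proof.
  unfold deck; simpl; rewrite !plus_IZR, !RtoC_plus.
  f_equal; ring.
Qed.

(** Within an orbit, moving [u] by [deck n] multiplies the fiber coordinate by [char n]. Thus
    [(deck n u, theta, 1)] and [(u, theta, 1 / char n theta)] are the same point of Q, whence the
    opposite index. *)
Lemma t0hat_deck (n : Z * Z) (u : C2) :
  t0hat (deck n u) = act_section (t0hat u) (char (oppZ2 n)).
Proof.
  assert (Hinv : forall theta, char n theta * char (oppZ2 n) theta = 1).
  { intros theta; rewrite <- char_plus, <- (char_0 theta).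
    f_equal; unfold oppZ2; simpl; f_equal; lia. }
  apply functional_extensionality; intros theta.
  apply functional_extensionality; intros q.
  apply propositional_extensionality.
  unfold t0hat, act_section, Q_act, orbit; split.
  - intros (k & m & ->).
    do 3 eexists; split.
    (* Orbit indices over [deck n u] and over [u] differ by the shift [n]. *)
    + exists (fst k + fst n, snd k + snd n)%Z, m; reflexivity.
    + rewrite deck_deck, char_plus; f_equal.
      rewrite <- (Hinv theta) at 1; ring.
  - intros (u' & theta' & l & (k & m & Hq) & ->).
    injection Hq as -> -> ->.
    exists (fst k - fst n, snd k - snd n)%Z, m.
    rewrite deck_deck; simpl.
    f_equal; [f_equal |].
    + replace k with (fst k - fst n + fst n, snd k - snd n + snd n)%Z at 1;
        [reflexivity |].
      destruct k; simpl; f_equal; ring.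
    + unfold oppZ2; rewrite !Cmult_1_r, <- char_plus; reflexivity.
Qed.

Lemma lift_t0hat (u : C2) : lift_at (cov u) (t0hat u) u (fun _ => 1).
Proof. repeat split; apply torus_map_1. Qed.

Lemma section_t0hat (u : C2) : section_at (cov u) (t0hat u).
Proof. exists u, (fun _ => 1); apply lift_t0hat. Qed.

(** * The transformation factor of a fiber element *)

Lemma spin_sign_Cexp (n : Z * Z) :
  spin_sign (spin_sigma (mod2 n)) = Cexp (PI * Ci * IZR (fst n * snd n)).
Proof.
  (* The conjunction of the two parities is the parity of the product, so the sign is
     [exp (pi i n1 n2)]. *)
  unfold spin_sigma, mod2; simpl; rewrite <- Z.odd_mul.
  set (m := (fst n * snd n)%Z).
  destruct (Z.odd m) eqn:Hm.
  - apply Z.odd_spec in Hm as [k ->].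
    replace (PI * Ci * IZR (2 * k + 1)) with (2 * PI * Ci * IZR k + Ci * PI)
      by (rewrite plus_IZR, mult_IZR, RtoC_plus, RtoC_mult; ring).
    rewrite Cexp_plus, Cexp_2PIi, Cexp_iR, cos_PI, sin_PI.
    unfold spin_sign, RtoC, Copp, Cmult; simpl; f_equal; ring.
  - assert (He : Z.even m = true) by (rewrite <- Z.negb_odd, Hm; reflexivity).
    apply Z.even_spec in He as [k ->].
    replace (PI * Ci * IZR (2 * k)) with (2 * PI * Ci * IZR k)
      by (rewrite mult_IZR, RtoC_mult; ring).
    rewrite Cexp_2PIi; reflexivity.
Qed.

Lemma PI_neq_0 : RtoC PI <> 0.
Proof. intros H; apply PI_neq0; injection H; trivial. Qed.

(** The relation defining the fiber is applied to the lift with [lambda = 1]. The sign is even in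
    [n], while the linear term is odd and so feels the opposite index. *)
Lemma in_fiber_t0hat_deck (u : C2) (n : Z * Z) (f : (plane -> Qpt) -> C) :
  in_fiber (cov u) f ->
  f (t0hat (deck n u))
  = Cexp (PI * Ci * IZR (fst n * snd n)
          + (IZR (snd n) * fst u - IZR (fst n) * snd u) / 2)
    * f (t0hat u).
Proof.
  intros Hf.
  rewrite t0hat_deck.
  rewrite (Hf _ u (fun _ => 1) (char (oppZ2 n)) (oppZ2 n) (lift_t0hat u)
             (torus_map_char _) (homotopy_class_char _)).
  rewrite spin_sign_Cexp, int_T_eta_dlog_char, <- Cexp_plus.
  do 2 f_equal.
  unfold oppZ2; simpl; f_equal.
  - do 3 f_equal; ring.
  - rewrite !opp_IZR, !RtoC_opp.
    (* The product of [- i / (4 pi)] and [2 pi i] is [- i^2 / 2]; the square is isolated because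
       [field] treats [Ci] as an atom. *)
    transitivity (- (Ci * Ci) / 2 * (IZR (snd n) * fst u - IZR (fst n) * snd u)).
    + field; apply PI_neq_0.
    + replace (Ci * Ci) with (- (1)); [field |].
      unfold Ci, RtoC, Copp, Cmult; simpl; f_equal; ring.
Qed.

(** * Comparison of [L] at [u] and at [deck n u] *)

Theorem theorem5p1
  (tau : C2 -> (plane -> Qpt) -> C) (L : C2 -> C)
  (Hflat : flat_section tau) (Hnonzero : nonzero_section tau)
  (HL : CS_function tau L)
  (u1 u2 : C) (n1 n2 : Z) (Hu : Mhat' (u1, u2)) :
  eq_mod_4pi2
    (L (u1 + 2 * PI * Ci * IZR n1, u2 + 2 * PI * Ci * IZR n2))
    (L (u1, u2) + PI * Ci * (IZR n1 * u2 - IZR n2 * u1)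
     + 2 * PI ^ 2 * IZR n1 * IZR n2).
Proof.
  destruct Hflat as [Hfib _].
  destruct HL as (tau0 & phi & Htau0 & Hphi & HL).
  set (u := (u1, u2)) in *.
  set (n := (n1, n2)).
  change (u1 + 2 * PI * Ci * IZR n1, u2 + 2 * PI * Ci * IZR n2) with (deck n u).
  assert (Hv : Mhat' (deck n u)).
  { change (fst (cov (deck n u)) + snd (cov (deck n u)) = 1).
    rewrite cov_deck; exact Hu. }
  assert (Hmu : M' (cov u)) by (repeat split; [apply Cexp_neq_0 .. | exact Hu]).
  (* Since [tau0 v] is 1 at [t0hat v], the quotient [phi v] is inverse to the value of [tau]
     there. *)
  assert (Hone : forall v, Mhat' v ->
            Cexp (L v / (2 * PI * Ci)) * tau (cov v) (t0hat v) = 1).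
  { intros v Hv'.
    rewrite <- HL, <- Hphi by (trivial; apply section_t0hat).
    apply Htau0. }
  pose proof (Hone u Hu) as Hone_u.
  pose proof (Hone _ Hv) as Hone_v.
  (* Both points lie over the same [mu], so the two identities concern a single fiber element. *)
  rewrite cov_deck, (in_fiber_t0hat_deck u n _ (Hfib _ Hmu)) in Hone_v.
  rewrite Cmult_assoc, <- Cexp_plus in Hone_v.
  set (w := tau (cov u) (t0hat u)) in *.
  assert (Hw : w <> 0).
  { intros H0; apply C1_nz; rewrite <- Hone_u, H0; ring. }
  assert (Heq : forall a, a * w = 1 -> a = / w).
  { intros a Ha; rewrite <- (Cmult_1_l (/ w)), <- Ha; field; exact Hw. }
  (* Both exponentials equal the inverse of [w], so their exponents differ by [2 pi i k]. *)
  destruct (Cexp_eq _ _ (eq_trans (Heq _ Hone_v) (eq_sym (Heq _ Hone_u))))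
    as [k Hk].
  assert (HCi : Ci <> 0) by (intros H; injection H; lra).
  assert (HCi2 : Ci * Ci = - (1)).
  { unfold Ci, RtoC, Copp, Cmult; simpl; f_equal; ring. }
  (* Clearing the denominator [2 pi i] turns [2 pi i k] into [- 4 pi^2 k], hence the sign of the
     witness. *)
  exists (- k)%Z.
  simpl in Hk; rewrite mult_IZR, RtoC_mult in Hk.
  rewrite opp_IZR, RtoC_opp.
  set (D := L (deck n u)) in *.
  set (E := L u) in *.
  assert (HD : D - E = 2 * PI * Ci * (2 * PI * Ci * IZR k
             - PI * Ci * (IZR n1 * IZR n2) - (IZR n2 * u1 - IZR n1 * u2) / 2)).
  { rewrite <- Hk; field; split; [exact HCi | exact PI_neq_0]. }
  transitivity ((D - E) - (PI * Ci * (IZR n1 * u2 - IZR n2 * u1)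
     + 2 * PI ^ 2 * IZR n1 * IZR n2)); [ring |].
  rewrite HD.
  (* The linear terms cancel here; replacing [i^2] by -1 then cancels the [n1 n2] terms and leaves
     [- 4 pi^2 k]. *)
  transitivity (Ci * Ci * (4 * PI ^ 2 * IZR k - 2 * PI ^ 2 * IZR n1 * IZR n2)
    - 2 * PI ^ 2 * IZR n1 * IZR n2); [field |].
  rewrite HCi2; ring.
Qed.
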